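(* (i) There is an absolute constant $C$ such that for every set $L$ of $n$ lines in the plane, the number of unordered triples of lines of $L$ that are pairwise non-parallel and not concurrent and bound a triangle of area exactly $1$ is at most $C n^{7/3}$. (ii) There is an absolute constant $c>0$ such that for every $n\ge 3$ there is a set of $n$ lines in the plane determining at least $c n^2$ such triangles of area $1$.
   Context: Three pairwise non-parallel lines in the plane that do not pass through a common point determine a triangle of positive area (the triangle whose sides lie on the three lines). *)

(* Defs.v *)
From HB Require Import structures.
From mathcomp Require Import all_boot all_order all_algebra finmap.
From mathcomp Require Import all_classical all_reals all_analysis.
Set Implicit Arguments.
Unset Strict Implicit.
Unset Printing Implicit Defensive.
Import Order.TTheory GRing.Theory Num.Theory.
Local Open Scope classical_set_scope.
Local Open Scope ring_scope.

Definition is_line (R : realType) (l : set (R * R)) : Prop :=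
  exists a b c : R, (a, b) <> (0, 0) /\ l = [set p | a * p.1 + b * p.2 = c].

Definition parallel (R : realType) (l m : set (R * R)) : Prop :=
  l = m \/ l `&` m = set0.

Definition triangle_area (R : realType) (p q r : R * R) : R :=
  `|(q.1 - p.1) * (r.2 - p.2) - (r.1 - p.1) * (q.2 - p.2)| / 2.

(* The vertices are the pairwise intersection points, which are unique because
   the lines are pairwise non-parallel. *)
Definition bound_unit_triangle (R : realType) (l1 l2 l3 : set (R * R)) : Prop :=
  [/\ ~ parallel l1 l2, ~ parallel l1 l3, ~ parallel l2 l3,
      l1 `&` l2 `&` l3 = set0
    & exists p q r : R * R,
        [/\ (l2 `&` l3) p, (l1 `&` l3) q, (l1 `&` l2) r
          & triangle_area p q r = 1]].

(* Unordered triples are represented as 3-element subsets of [L]. *)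
Definition unit_triples (R : realType) (L : {fset set (R * R)}) :
    {fset {fset set (R * R)}} :=
  [fset T in fpowerset L | (#|` T| == 3)%N &&
     `[< exists l1 l2 l3, T = [fset l1; l2; l3]%fset
                          /\ bound_unit_triangle l1 l2 l3 >]]%fset.

(* Main.v *)
(** Upper bound: fix one line [l0] of the triple and use coordinates in which
    it is the axis [eta = 0].  A line [xi = al + mu * eta] crossing it becomes
    a point of the [(al, mu)]-plane, and after rescaling [mu] two such lines
    bound with [l0] a triangle of area 1 only if one of the two points lies on
    the unit parabola with apex at the other.  Subtracting a fixed parabola
    turns this into point-line incidences, so Szemeredi-Trotter gives
    O(n^(4/3)) pairs for each [l0].

    Szemeredi-Trotter is obtained by Szekely's method: the segments between
    consecutive points on the lines form a drawn graph with at most n^2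
    crossings, and a random vertex sample amplifies the linear bound on the
    number of edges of a plane graph.  That linear bound comes from charging
    each edge that is not the edge of greatest slope leaving its left endpoint [p]
    to the first vertex met when sweeping rightwards the wedge between it and
    the edge of next greater slope at [p].

    Lower bound: in the grid of lines [x = r i], [y = r j], [x + y = r l] with
    [r = sqrt 2], the three lines bound a triangle of area 1 when
    [l = i + j + 1]. *)

Require Import Defs.
From HB Require Import structures.
From mathcomp Require Import all_boot all_order all_algebra finmap.
From mathcomp Require Import all_classical all_reals all_analysis.
From mathcomp Require Import ring lra zify.
Set Implicit Arguments.
Unset Strict Implicit.
Unset Printing Implicit Defensive.
Import Order.TTheory GRing.Theory Num.Theory.
Local Open Scope ring_scope.

(** * Counting by injective charges *)

(** Charging by a relation lets the target be given by mere existence. Choice then supplies a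
    function, into [option T] because [T] may be empty. *)
Lemma leq_card_charge (S T : finType) (A : {set S}) (B : {set T})
    (r : S -> T -> Prop) :
  (forall a, a \in A -> exists2 b, b \in B & r a b) ->
  (forall a a' b, a \in A -> a' \in A -> r a b -> r a' b -> a = a') ->
  (#|A| <= #|B|)%N.
Proof.
move=> rex rinj.
have /choice [f fP] (a : S) : exists b : option T,
    a \in A -> exists2 c, b = Some c & c \in B /\ r a c.
  have [aA|aNA] := boolP (a \in A); last by exists None.
  by have [b bB rab] := rex a aA; exists (Some b) => _; exists b.
rewrite -(card_in_imset (f := f)); last first.
  move=> a a' aA a'A; have [c -> [_ rac]] := fP a aA.
  have [c' -> [_ rac']] := fP a' a'A => -[cc']; move: rac'; rewrite -cc'.
  exact: rinj.
have SomeI : injective (@Some T) by move=> b c [].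
rewrite -(card_imset B SomeI); apply: subset_leq_card.
apply/fintype.subsetP => o /imsetP [a aA ->]; have [c -> [cB _]] := fP a aA.
exact: imset_f.
Qed.

(** * Random subsets *)

Section Sampling.
Variables (R : realFieldType) (T : finType) (p : R).

(** The probability of drawing exactly [S] when each element is kept independently with probability
    [p]. *)
Definition sample_weight (S : {set T}) : R :=
  \prod_i (if i \in S then p else 1 - p).

Lemma sample_weight_ge0 S : 0 <= p <= 1 -> 0 <= sample_weight S.
Proof.
move=> /andP[p0 p1]; apply: prodr_ge0 => i _.
by case: ifP; rewrite ?subr_ge0.
Qed.

Lemma sum_sample_weight (A : {set T}) :
  \sum_(S : {set T} | A \subset S) sample_weight S = p ^+ #|A|.
Proof.
(* Expanding this product enumerates the subsets [S]; the factor 0 kills those that miss an element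
   of [A]. *)
transitivity (\prod_i (p + (if i \in A then 0 else 1 - p))); last first.
  rewrite -prodr_const [RHS]big_mkcond; apply: eq_bigr => i _.
  by case: ifP => _; ring.
rewrite bigA_distr big_mkcond; apply: eq_bigr => S _.
case: ifPn => [/fintype.subsetP AS|/fintype.subsetPn [i iA iNS]].
  apply: eq_bigr => i _; case: ifPn => // iNS.
  by case: ifPn => // /AS; rewrite (negPf iNS).
by rewrite (bigD1 i) //= (negPf iNS) iA mul0r.
Qed.

(** Linearity of expectation: each [a] survives with probability [p ^+ k]. *)
Lemma sum_sample_card (I : finType) (A : {set I}) (B : I -> {set T}) k :
  (forall a, a \in A -> #|B a| = k) ->
  \sum_(S : {set T}) sample_weight S * #|[set a in A | B a \subset S]|%:R
  = #|A|%:R * p ^+ k.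
Proof.
move=> Bk; transitivity (\sum_(a in A) p ^+ k); last first.
  by rewrite sumr_const mulr_natl.
under eq_bigr => S _.
  rewrite -sum1_card natr_sum mulr_sumr big_mkcond /=.
  under eq_bigr => a _ do rewrite inE mulr1.
  over.
rewrite exchange_big [RHS]big_mkcond; apply: eq_bigr => a _ /=.
case: (boolP (a \in A)) => aA /=; last by rewrite big1.
by rewrite -big_mkcond sum_sample_weight Bk.
Qed.

End Sampling.

(** * The drawn graph of points and non-vertical lines *)

Section Incidences.
Variables (R : realFieldType) (P La : finType).
Variables (x y : P -> R) (u v : La -> R).
Hypothesis point_inj : forall p q, x p = x q -> y p = y q -> p = q.
Hypothesis line_inj : forall s t, u s = u t -> v s = v t -> s = t.

Local Notation edge := (La * (P * P))%type.

Definition line_at s z := u s * z + v s.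

Definition incident s p := y p == line_at s (x p).

(* An edge [(s, (p, q))] is the segment of the line [s] from the point [p] to
   the next point [q] of [s] on its right. *)
Definition is_edge (e : edge) :=
  [&& incident e.1 e.2.1, incident e.1 e.2.2, x e.2.1 < x e.2.2 &
      [forall r, ~~ [&& incident e.1 r, x e.2.1 < x r & x r < x e.2.2]]].

(** For equal slopes the quotient is 0 by convention, hence the separate slope test in [crosses]. *)
Definition crossing_abscissa s t := (v t - v s) / (u s - u t).

Definition crosses (e f : edge) :=
  let z := crossing_abscissa e.1 f.1 in
  [&& u e.1 != u f.1, x e.2.1 < z < x e.2.2 & x f.2.1 < z < x f.2.2].

Lemma crossing_abscissa_between s t z1 z2 : z1 < z2 ->
  line_at s z1 < line_at t z1 -> line_at t z2 < line_at s z2 ->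
  u s != u t /\ z1 < crossing_abscissa s t < z2.
Proof.
move=> z12; rewrite /line_at => h1 h2.
have d0 : 0 < u s - u t.
  have : 0 < (u s - u t) * (z2 - z1) by lra.
  by rewrite pmulr_lgt0 // subr_gt0.
split; first by rewrite -subr_eq0 gt_eqF.
by rewrite /crossing_abscissa ltr_pdivlMr // ltr_pdivrMr //; lra.
Qed.

Lemma crossesI e f z1 z2 : z1 < z2 ->
  line_at e.1 z1 < line_at f.1 z1 -> line_at f.1 z2 < line_at e.1 z2 ->
  x e.2.1 <= z1 -> x f.2.1 <= z1 -> z2 <= x e.2.2 -> z2 <= x f.2.2 ->
  crosses e f.
Proof.
move=> z12 h1 h2 e1 f1 e2 f2.
have [ne /andP[zl zr]] := crossing_abscissa_between z12 h1 h2.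
rewrite /crosses ne (le_lt_trans e1 zl) (le_lt_trans f1 zl).
by rewrite (lt_le_trans zr e2) (lt_le_trans zr f2).
Qed.

(** No point of a line lies inside an edge on it, so its edges occupy disjoint intervals. These are
    half-open because consecutive edges share an endpoint. *)
Lemma edge_overlap e f z : is_edge e -> is_edge f -> e.1 = f.1 ->
  x e.2.1 < z <= x e.2.2 -> x f.2.1 < z <= x f.2.2 -> e = f.
Proof.
case: e f => [s [p q]] [t [p' q']] /= /and4P[/= sp sq pq /forallP emp].
move=> /and4P[/= tp' tq' pq' /forallP emp'] st.
subst t => /andP[pz zq] /andP[pz' zq'].
have pp' : p = p'.
  case: (ltgtP (x p) (x p')) => [lt|lt|xpp'].
  - by have := emp p'; rewrite tp' lt (lt_le_trans pz' zq).
  - by have := emp' p; rewrite sp lt (lt_le_trans pz zq').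
  - by apply: point_inj => //; rewrite (eqP sp) (eqP tp') xpp'.
subst p'; congr (_, (_, _)).
case: (ltgtP (x q) (x q')) => [lt|lt|xqq'].
- by have := emp' q; rewrite sq lt pq.
- by have := emp q'; rewrite tq' lt pq'.
- by apply: point_inj => //; rewrite (eqP sq) (eqP tq') xqq'.
Qed.

(** A common left or right endpoint would be the intersection of the two lines, which is interior to
    both edges. The four distinct endpoints give a crossing survival probability [p ^+ 4]. *)
Lemma crosses_ends e f : is_edge e -> is_edge f -> crosses e f ->
  #|[set e.2.1; e.2.2; f.2.1; f.2.2]| = 4.
Proof.
case: e f => [s [p q]] [t [p' q']] /and4P[/= sp sq pq _].
move=> /and4P[/= tp' tq' pq' _] /and3P[/= ust].
move=> /andP[pz zq] /andP[pz' zq'].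
have apex r : incident s r -> incident t r -> x r = crossing_abscissa s t.
  move=> /eqP sr /eqP; rewrite sr /line_at => h.
  rewrite /crossing_abscissa; apply/(canRL (mulfK _)); first by rewrite subr_eq0.
  lra.
have pNp' : p != p'.
  by apply: contraTneq pz => e; rewrite (apex p) ?ltxx // e.
have qNq' : q != q'.
  by apply: contraTneq zq => e; rewrite (apex q) ?ltxx // e.
have pNq : p != q by apply: contraTneq pq => ->; rewrite ltxx.
have pNq' : p' != q' by apply: contraTneq pq' => ->; rewrite ltxx.
have pNq'' : p != q'.
  by apply: contraTneq (lt_trans pz zq') => ->; rewrite ltxx.
have qNp' : q != p'.
  by apply: contraTneq (lt_trans pz' zq) => ->; rewrite ltxx.
have uniq4 : uniq [:: p; q; p'; q'].
  by rewrite /= !inE !negb_or pNq pNp' pNq'' qNp' qNq' pNq'.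
rewrite -[RHS](card_uniqP uniq4); apply: eq_card => r.
by rewrite !inE -!orbA.
Qed.


(** * Linear edge bound for plane graphs *)

Definition next_edge (F : {set edge}) (e f : edge) :=
  [/\ f \in F, f.2.1 = e.2.1, u e.1 < u f.1 &
      forall g, g \in F -> g.2.1 = e.2.1 -> u e.1 < u g.1 -> u f.1 <= u g.1].

Definition in_wedge (e f : edge) w :=
  line_at e.1 (x w) <= y w <= line_at f.1 (x w).

Definition closes_wedge (V : {set P}) (e f : edge) w :=
  [/\ x e.2.1 < x w, x w <= x e.2.2, x w <= x f.2.2, in_wedge e f w &
      forall w', w' \in V -> x e.2.1 < x w' < x w -> ~~ in_wedge e f w'].

(* If [e'] does not start to the left of [e], its left endpoint lies outside the wedge
   of [e], so [e'] or [f'] has to cross [f] or [e] to reach [w]. *)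
Lemma closes_wedge_uniq (F : {set edge}) (V : {set P}) e f e' f' w :
  {in F, forall g, is_edge g} -> {in F &, forall g h, ~~ crosses g h} ->
  {in F, forall g, g.2.1 \in V} ->
  e \in F -> e' \in F -> next_edge F e f -> next_edge F e' f' ->
  closes_wedge V e f w -> closes_wedge V e' f' w ->
  line_at e'.1 (x w) < line_at f.1 (x w) ->
  line_at e.1 (x w) < line_at f'.1 (x w) -> e = e'.
Proof.
move=> Fedge Fplane FV; wlog pp' : e f e' f' / x e.2.1 <= x e'.2.1.
  move=> wl eF e'F ef ef' efw ef'w lt lt'.
  have [le|/ltW le] := leP (x e.2.1) (x e'.2.1); first exact: (wl e f e' f').
  by apply/esym; apply: (wl e' f' e f).
move=> eF e'F [fF fe uef fmin] [f'F f'e' uef' fmin'].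
move=> [pw wqe wqf we wmin] [p'w wqe' wqf' we' wmin'] lt lt'.
have atp g : g \in F -> y g.2.1 = line_at g.1 (x g.2.1).
  by move=> /Fedge /and4P[/eqP].
(* From a common left endpoint, the next edge above the flatter of [e] and [e'] has at most the
   slope of the steeper one, against [lt] or [lt']. *)
have [eqp|nep] := eqVneq e.2.1 e'.2.1.
  have no g h : g \in F -> h \in F -> g.2.1 = h.2.1 -> x h.2.1 < x w ->
      u g.1 <= u h.1 -> line_at g.1 (x w) <= line_at h.1 (x w).
    move=> gF hF gh hw ugh; have := atp g gF; have := atp h hF.
    rewrite gh /line_at => -> E.
    have : 0 <= (u h.1 - u g.1) * (x w - x h.2.1).
      by rewrite mulr_ge0 // subr_ge0 // ltW.
    lra.
  have [ul|ul|ue] := ltgtP (u e.1) (u e'.1).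
  - by move: lt; rewrite ltNge no //; [rewrite fe|apply: fmin].
  - move: lt'; rewrite ltNge no //; first by rewrite f'e'.
    by apply: fmin'.
  - have ve : e.1 = e'.1.
      apply: line_inj => //; have := atp e eF; have := atp e' e'F.
      by rewrite eqp /line_at ue => -> /addrI.
    by apply: (edge_overlap (z := x w)); rewrite ?Fedge ?pw ?p'w.
(* If both edges start at the same abscissa, the wedge of [e] is there only its apex, so the left
   endpoints would coincide. *)
have p'out : ~~ in_wedge e f e'.2.1.
  move: pp'; rewrite le_eqVlt => /orP[/eqP eqx|ltp]; last first.
    by apply: wmin; rewrite ?FV // ltp.
  apply: contra nep => /andP[le1 le2]; apply/eqP/point_inj => //.
  apply/le_anti/andP; split.
    by rewrite (atp e) // eqx.
  by rewrite -fe (atp f) // fe eqx.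
move: p'out; rewrite negb_and -!ltNge => /orP[below|above].
- have /negP[] := Fplane f' e f'F eF.
  by apply: (crossesI (z1 := x e'.2.1) (z2 := x w)); rewrite ?f'e' //
    -f'e' -atp ?f'e'.
- have /negP[] := Fplane f e' fF e'F.
  by apply: (crossesI (z1 := x e'.2.1) (z2 := x w)); rewrite ?fe // -atp.
Qed.

(** The 3 counts injective charges: two for wedges, and one sending each edge of greatest slope to
    its left endpoint. *)
Lemma planar_edge_bound (F : {set edge}) (V : {set P}) :
  {in F, forall g, is_edge g} -> {in F &, forall g h, ~~ crosses g h} ->
  {in F, forall g, g.2.1 \in V} -> {in F, forall g, g.2.2 \in V} ->
  (#|F| <= 3 * #|V|)%N.
Proof.
move=> Fedge Fplane FV1 FV2.
(* [w] may lie on [e] or on [f]; each of the two sorts of charge excludes one of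
   these cases, which makes it injective. *)
pose charge (above : bool) (e : edge) w := exists f,
  [/\ next_edge F e f, closes_wedge V e f w &
    if above then line_at e.1 (x w) < y w else y w < line_at f.1 (x w)].
pose A top := [set e in F | `[< exists2 w, w \in V & charge top e w >]].
pose B := [set e in F | [forall f in F, (f.2.1 == e.2.1) ==> (u f.1 <= u e.1)]].
have cardA top : (#|A top| <= #|V|)%N.
  apply: (leq_card_charge (r := charge top)).
    by move=> e; rewrite inE => /andP[_ /asboolP].
  move=> e e' w; rewrite !inE => /andP[eF _] /andP[e'F _].
  move=> [f [ef cw c]] [f' [ef' cw' c']].
  have [_ _ _ /andP[l1 l2] _] := cw; have [_ _ _ /andP[l1' l2'] _] := cw'.
  by apply: (closes_wedge_uniq Fedge Fplane FV1 eF e'F ef ef' cw cw');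
    case: top c c' => c c'; lra.
have cardB : (#|B| <= #|V|)%N.
  apply: (leq_card_charge (r := fun e p => e.2.1 = p)).
    by move=> e; rewrite inE => /andP[/FV1 ? _]; exists e.2.1.
  move=> e e' p; rewrite !inE => /andP[eF /forallP top] /andP[e'F /forallP top'].
  move=> ep e'p.
  have ue : u e.1 = u e'.1.
    apply/le_anti/andP; split.
      by have := top' e; rewrite eF ep e'p eqxx.
    by have := top e'; rewrite e'F ep e'p eqxx.
  have /and4P[/eqP ye _ lte _] := Fedge e eF.
  have /and4P[/eqP ye' _ lte' _] := Fedge e' e'F.
  have ve : e.1 = e'.1.
    apply: line_inj => //; move: ye ye'.
    by rewrite ep e'p /line_at ue => -> /addrI.
  apply: (edge_overlap (z := Num.min (x e.2.2) (x e'.2.2))); rewrite ?Fedge //.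
    by rewrite ge_min lexx lt_min lte ep -e'p lte'.
  by rewrite ge_min lexx orbT lt_min lte' e'p -ep lte.
suff sFAB : F \subset A true :|: A false :|: B.
  apply: leq_trans (subset_leq_card sFAB) _.
  rewrite !mulSn mul0n addn0 addnA.
  apply: leq_trans (leq_card_setU _ _) _; rewrite leq_add //.
  by apply: leq_trans (leq_card_setU _ _) _; rewrite leq_add.
apply/fintype.subsetP => e eF; rewrite !inE eF /=.
have [top|/forallPn[f0]] :=
    boolP [forall f in F, (f.2.1 == e.2.1) ==> (u f.1 <= u e.1)].
  by rewrite orbT.
rewrite !negb_imply -ltNge => /and3P[f0F f0e uef0]; rewrite orbF.
have [f ef] : exists f, next_edge F e f.
  pose Q := fun f : edge => [&& f \in F, f.2.1 == e.2.1 & u e.1 < u f.1].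
  have Qf0 : Q f0 by rewrite /Q f0F f0e uef0.
  case: (arg_minP (fun f : edge => u f.1) Qf0).
  move=> f /and3P[fF /eqP fe uef] fmin.
  exists f; split=> // g gF ge ueg.
  by apply: fmin; rewrite /Q gF ge eqxx ueg.
have [fF fe uef _] := ef.
have /and4P[/eqP ye /eqP yeq lte _] := Fedge e eF.
have /and4P[/eqP yf /eqP yfq ltf _] := Fedge f fF.
have efw w : x e.2.1 < x w -> line_at e.1 (x w) < line_at f.1 (x w).
  move=> lw; move: ye yf; rewrite fe /line_at => -> E.
  have : 0 < (u f.1 - u e.1) * (x w - x e.2.1) by rewrite mulr_gt0 // subr_gt0.
  lra.
pose Q := fun w => [&& w \in V, x e.2.1 < x w, x w <= x e.2.2, x w <= x f.2.2
    & in_wedge e f w].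
(* The nearer right endpoint lies on a side of the closed wedge, so the sweep does meet a vertex. *)
have [w0 Qw0] : exists w0, Q w0.
  have [le|/ltW le] := leP (x e.2.2) (x f.2.2).
    exists e.2.2; rewrite /Q FV2 // lte lexx le /in_wedge yeq lexx ltW //.
    exact: efw.
  exists f.2.2; rewrite /Q FV2 // -fe ltf lexx le /in_wedge yfq lexx andbT.
  by rewrite ltW // efw // -fe.
case: (arg_minP x Qw0) => w /and5P[wV pw wq wq' ww] wmin.
have cw : closes_wedge V e f w.
  split=> // w' w'V /andP[pw' w'w]; apply/negP => ww'.
  have := wmin w'; rewrite leNgt w'w => /(_ _)/negP; apply => //.
  by rewrite /Q w'V pw' ww' !(le_trans (ltW w'w)).
(* The wedge has positive height at [x w], so [w] misses at least one side. *)
have /orP[lw|lw] : (line_at e.1 (x w) < y w) || (y w < line_at f.1 (x w)).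
  have lt := efw w pw; have [//|le] := ltP (line_at e.1 (x w)) (y w).
  by rewrite (le_lt_trans le lt).
- by apply/orP; left; apply/asboolP; exists w => //; exists f.
- by apply/orP; right; apply/asboolP; exists w => //; exists f.
Qed.

(** * Crossing inequality by random sampling *)

Definition edges : {set edge} := [set e | is_edge e].

Definition crossings : {set edge * edge} :=
  [set ef in finset.setX edges edges | crosses ef.1 ef.2].

(** Two lines of different slopes meet at one abscissa, which is interior to at most one edge of
    each; pairs are ordered on both sides of the bound. *)
Lemma card_crossings : (#|crossings| <= #|La| ^ 2)%N.
Proof.
rewrite -mulnn -card_prod -cardsT.
apply: (leq_card_charge (r := fun ef st => (ef.1.1, ef.2.1) = st)) => [ef _|].
  by exists (ef.1.1, ef.2.1).
move=> [e f] [e' f'] [s t]; rewrite !inE /=.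
move=> /andP[/andP[ee ef] /and3P[_ /andP[pz zq] /andP[pz' zq']]].
move=> /andP[/andP[ee' ef'] /and3P[_ tz tz']] [es ft] [e's f't].
move: tz tz'; rewrite e's f't -es -ft => /andP[tz zr] /andP[tz' zr'].
congr pair; apply: (edge_overlap (z := crossing_abscissa e.1 f.1)) => //;
  rewrite ?es ?ft ?e's ?f't //; rewrite -?es -?ft.
- by rewrite pz ltW.
- by rewrite tz ltW.
- by rewrite pz' ltW.
- by rewrite tz' ltW.
Qed.

(** Uncrossed edges form a plane graph; every other edge is charged to a crossing in which it comes
    first. *)
Lemma card_edges_within (V : {set P}) :
  (#|[set e in edges | [set e.2.1; e.2.2] \subset V]| <=
   3 * #|V| + #|[set ef in crossings |
                 [set ef.1.2.1; ef.1.2.2; ef.2.2.1; ef.2.2.2] \subset V]|)%N.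
Proof.
set EV := [set e in edges | _]; set XV := [set ef in crossings | _].
pose F := [set e in EV | [forall f in EV, ~~ crosses e f]].
have EVP e : e \in EV -> [/\ is_edge e, e.2.1 \in V & e.2.2 \in V].
  by rewrite !inE finset.subUset !finset.sub1set => /and3P[].
have FEV : {subset F <= EV} by move=> e; rewrite inE => /andP[].
have cardF : (#|F| <= 3 * #|V|)%N.
  apply: planar_edge_bound => [e /FEV/EVP[]//|e f|e /FEV/EVP[]//|e /FEV/EVP[]//].
  by rewrite inE => /andP[_ /forallP /(_ f) /implyP h] /FEV.
have cardD : (#|EV :\: F| <= #|XV|)%N.
  apply: (leq_card_charge (r := fun e ef => ef.1 = e)); last first.
    by move=> e e' ef _ _ <- <-.
  move=> e; rewrite inE => /andP[] /[swap] eEV; rewrite inE eEV /=.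
  move=> /forallPn[f]; rewrite negb_imply negbK => /andP[fEV ef].
  exists (e, f) => //.
  have [ee e1 e2] := EVP e eEV; have [fe f1 f2] := EVP f fEV.
  by rewrite !inE /= ee fe ef !finset.subUset !finset.sub1set e1 e2 f1 f2.
rewrite -(cardsID F EV) leq_add //.
by apply: leq_trans cardF; rewrite subset_leq_card // finset.subsetIr.
Qed.

(** This is the expectation of [card_edges_within] over a random [V]. *)
Lemma crossing_inequality (p : R) : 0 <= p <= 1 ->
  #|edges|%:R * p ^+ 2 <= 3 * #|P|%:R * p + #|La|%:R ^+ 2 * p ^+ 4.
Proof.
move=> p01.
have ends2 e : e \in edges -> #|[set e.2.1; e.2.2]| = 2.
  rewrite inE => /and4P[_ _ lt _]; rewrite cards2.
  by case: eqP lt => // ->; rewrite ltxx.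
have ends4 ef : ef \in crossings ->
    #|[set ef.1.2.1; ef.1.2.2; ef.2.2.1; ef.2.2.2]| = 4.
  rewrite !inE => /andP[/andP[e1 e2]]; exact: crosses_ends.
have ends1 q : q \in [set: P] -> #|[set q]| = 1%N by rewrite cards1.
have := sum_sample_card p ends2; have := sum_sample_card p ends4.
have := sum_sample_card p ends1; rewrite cardsT expr1 => s1 s4 <-.
apply: (@le_trans _ _ (3 * (#|P|%:R * p) + #|crossings|%:R * p ^+ 4)).
  rewrite -s1 -s4 mulr_sumr -big_split; apply: ler_sum => V _ /=.
  rewrite mulrCA -mulrDr; apply: ler_wpM2l; first exact: sample_weight_ge0.
  rewrite -natrM -natrD ler_nat (_ : [set q in [set: P] | _] = V).
    exact: card_edges_within.
  by apply/setP => q; rewrite !inE finset.sub1set.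
rewrite mulrA lerD2l; apply: ler_wpM2r; first by rewrite exprn_ge0 //; lra.
by rewrite -natrX ler_nat card_crossings.
Qed.

(** * Szemeredi-Trotter bound *)

(** Each incidence starts an edge, except at the rightmost point of a line. *)
Lemma card_incidences :
  (#|[set sp : La * P | incident sp.1 sp.2]| <= #|La| + #|edges|)%N.
Proof.
set I := [set sp | _].
pose K := [set sp in I | [forall q, incident sp.1 q ==> (x q <= x sp.2)]].
have cardK : (#|K| <= #|La|)%N.
  rewrite -cardsT; apply: (leq_card_charge (r := fun sp s => sp.1 = s)).
    by move=> sp _; exists sp.1.
  move=> [s p] [t q] r; rewrite !inE /= => /andP[sp /forallP spm].
  move=> /andP[tq /forallP tqm] sr tr; subst s t; congr pair.
  have xpq : x p = x q.
    have := spm q; have := tqm p; rewrite sp tq /= => l1 l2.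
    by apply/le_anti; rewrite l1 l2.
  by apply: point_inj => //; rewrite (eqP sp) (eqP tq) xpq.
have cardD : (#|I :\: K| <= #|edges|)%N.
  apply: (leq_card_charge (r := fun sp e => (e.1, e.2.1) = sp)); last first.
    by move=> sp sp' e _ _ <- <-.
  move=> [s p]; rewrite inE => /andP[] /[swap] spI; rewrite inE spI /=.
  move: spI; rewrite inE /= => sp.
  move=> /forallPn[q0]; rewrite negb_imply -ltNge => Qq0.
  case: (@arg_minP _ _ _ q0 (fun q => incident s q && (x p < x q)) x Qq0).
  move=> q /andP[sq pq] qmin; exists (s, (p, q)) => //.
  rewrite inE /is_edge /= sp sq pq; apply/forallP => r; apply/negP.
  move=> /and3P[sr pr rq]; have := qmin r; rewrite sr pr leNgt rq.
  by move/(_ isT).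
rewrite -(cardsID K I) leq_add //.
by apply: leq_trans cardK; rewrite subset_leq_card // finset.subsetIr.
Qed.

(** The number [z] bounds the cube roots of both sizes, which avoids fractional powers. Sampling
    with probability [z^-1] bounds the edges by [(3 + 1) * z ^+ 4]; the lines add at most
    [z ^+ 3]. *)
Theorem szemeredi_trotter (z : R) : 1 <= z -> #|P|%:R <= z ^+ 3 ->
  #|La|%:R <= z ^+ 3 ->
  #|[set sp : La * P | incident sp.1 sp.2]|%:R <= 5 * z ^+ 4.
Proof.
move=> z1 Pz Lz.
have z0 : 0 < z by lra.
have zV : 0 <= z^-1 <= 1 by rewrite invr_ge0 ltW //= invf_le1.
have := crossing_inequality zV; set E := #|edges|%:R => ineq.
have E4 : E <= 4 * z ^+ 4.
  have -> : E = (E * z^-1 ^+ 2) * z ^+ 2 by field; lra.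
  have -> : 4 * z ^+ 4 = (3 * z ^+ 3 * z^-1 + (z ^+ 3) ^+ 2 * z^-1 ^+ 4) * z ^+ 2.
    by field; lra.
  apply: ler_wpM2r; first by rewrite exprn_ge0 // ltW.
  apply: le_trans ineq _; apply: lerD.
    by apply: ler_wpM2r; [rewrite invr_ge0 ltW|lra].
  apply: ler_wpM2r; first by rewrite exprn_ge0 // invr_ge0 ltW.
  by rewrite ler_pXn2r // nnegrE ?ler0n // exprn_ge0 // ltW.
have := card_incidences; rewrite -(ler_nat R) natrD => /le_trans; apply.
have : z ^+ 3 <= z ^+ 4 by apply: ler_weXn2l.
rewrite -/E; lra.
Qed.

End Incidences.

(** * Incidences with translated unit parabolas *)

(** The sign of [m s - m t] selects one of two parabolas; applying [half] to [m] and to [- m] gives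
    5 + 5. *)
Lemma card_unit_parabola_pairs (R : realFieldType) (S : finType) (a m : S -> R)
    (z : R) :
  (forall s t, a s = a t -> m s = m t -> s = t) ->
  1 <= z -> #|S|%:R <= z ^+ 3 ->
  #|[set st : S * S | (a st.1 - a st.2) ^+ 2 == 2 * `|m st.1 - m st.2|]|%:R
  <= 10 * z ^+ 4.
Proof.
move=> am_inj z1 Sz.
have half (m' : S -> R) : (forall s t, a s = a t -> m' s = m' t -> s = t) ->
    #|[set st : S * S | (a st.1 - a st.2) ^+ 2 == 2 * (m' st.2 - m' st.1)]|%:R
    <= 5 * z ^+ 4.
  move=> inj.
  (* Expanding the square gives [2 m' t - a t ^ 2 = - 2 a s a t + 2 m' s + a s ^ 2]: a point
     depending on [t] lies on a line depending on [s]. *)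
  have := @szemeredi_trotter R S S a (fun t => 2 * m' t - a t ^+ 2)
    (fun s => - 2 * a s) (fun s => 2 * m' s + a s ^+ 2) _ _ z z1 Sz Sz.
  rewrite (_ : [set sp | incident _ _ _ _ _ _] =
      [set st : S * S | (a st.1 - a st.2) ^+ 2 == 2 * (m' st.2 - m' st.1)]).
    apply=> s t; first by move=> e h; apply: inj => //; move: h; rewrite e; lra.
    move=> e h; have e' : a s = a t by lra.
    by apply: inj => //; move: h; rewrite e'; lra.
  apply/setP => -[s t]; rewrite !inE /incident /line_at /=.
  by apply/eqP/eqP; lra.
have h1 := half m am_inj.
have h2 := half (fun s => - m s) (fun s t e h => am_inj s t e (oppr_inj h)).
set A := [set st | _]; set A1 := [set st | _] in h1; set A2 := [set st | _] in h2.
have /subset_leq_card/leq_trans/(_ (leq_card_setU _ _)) : A \subset A1 :|: A2.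
  apply/fintype.subsetP => -[s t]; rewrite !inE /= => /eqP ->.
  have [le|/ltW le] := leP (m s) (m t).
    by rewrite distrC ger0_norm ?subr_ge0 // eqxx.
  by rewrite ger0_norm ?subr_ge0 // opprK addrC eqxx orbT.
rewrite -(ler_nat R) natrD; lra.
Qed.

(** * Unit triangles with a side on a fixed line *)

Section FixedLine.
Local Open Scope classical_set_scope.
Variables (R : realType) (a0 b0 c0 : R).
Hypothesis ab0 : (a0, b0) <> (0, 0).

Let l0 : set (R * R) := [set p | a0 * p.1 + b0 * p.2 = c0].
(** Here [xi] runs along [l0] and [eta] across it. They are not normalised: areas get multiplied by
    [k]. *)
Let xi (p : R * R) := a0 * p.2 - b0 * p.1.
Let eta (p : R * R) := a0 * p.1 + b0 * p.2 - c0.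
Let k := a0 ^+ 2 + b0 ^+ 2.

Let k_gt0 : 0 < k.
Proof.
have a2 := sqr_ge0 a0; have b2 := sqr_ge0 b0.
rewrite lt_neqAle addr_ge0 // andbT eq_sym; apply/eqP => k0; apply: ab0.
have /eqP : a0 ^+ 2 = 0 by rewrite /k in k0; lra.
have /eqP : b0 ^+ 2 = 0 by rewrite /k in k0; lra.
by rewrite !sqrf_eq0 => /eqP -> /eqP ->.
Qed.

Lemma nonparallel_line_coords (l : set (R * R)) :
  is_line l -> ~ parallel l0 l ->
  exists al mu : R, l = [set p | xi p = al + mu * eta p].
Proof.
move=> [a [b [c [ab ->]]]] npar.
pose D := a0 * b - a * b0.
have D0 : D != 0.
  apply/eqP => D0; apply: npar.
  (* When [D = 0] the normal vectors are proportional with factor [t], so the lines are equal or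
     disjoint. *)
  pose t := (a * a0 + b * b0) / k.
  have at0 : a = t * a0.
    rewrite /t mulrAC; apply/(canRL (mulfK _)); first by rewrite gt_eqF.
    have : b0 * D = 0 by rewrite D0 mulr0.
    rewrite /k /D; lra.
  have bt0 : b = t * b0.
    rewrite /t mulrAC; apply/(canRL (mulfK _)); first by rewrite gt_eqF.
    have : a0 * D = 0 by rewrite D0 mulr0.
    rewrite /k /D; lra.
  have t0 : t != 0.
    by apply/eqP => t0; apply: ab; rewrite at0 bt0 t0 !mul0r.
  have [ct|ct] := eqVneq c (t * c0).
    left; apply/seteqP; split=> p; rewrite /l0 /= at0 bt0 ct.
      by move=> <-; ring.
    by move=> h; apply: (mulfI t0); rewrite -h; ring.
  right; rewrite -subset0 => p [/= h1 h2]; move/eqP: ct; apply.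
  by rewrite -h2 -h1 at0 bt0; ring.
(* The line has the equation [D xi + E (eta + c0) = c k], to be solved for [xi]. *)
pose E := a * a0 + b * b0.
exists ((c * k - E * c0) / D), (- E / D).
apply/seteqP; split=> p /=.
  move=> h; rewrite -h /xi /eta /E /k; move: D0; rewrite /D => D0; field.
  exact: D0.
move=> h; have : D * xi p = c * k - E * c0 - E * eta p.
  by rewrite h; field.
move=> {}h; apply: (mulfI (lt0r_neq0 k_gt0)).
move: h; rewrite /D /xi /eta /E /k; lra.
Qed.

(** The base on [l0] is [al3 - al2] and the height [eta p] satisfies
    [(mu2 - mu3) * eta p = al3 - al2]. Multiplying twice the area by [mu2 - mu3] eliminates the
    height. *)
Lemma unit_area_coords (p q r : R * R) (al2 mu2 al3 mu3 : R) :
  xi p = al2 + mu2 * eta p -> xi p = al3 + mu3 * eta p ->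
  eta q = 0 -> xi q = al3 -> eta r = 0 -> xi r = al2 ->
  triangle_area p q r = 1 ->
  (al2 - al3) ^+ 2 = 2 * `|k * mu2 - k * mu3|.
Proof.
move=> hp2 hp3 hq hq' hr hr'; rewrite /triangle_area.
set cr := (X in `|X|) => area.
have crE : k * cr = eta p * (al3 - al2).
  have -> : k * cr = (xi r - xi p) * (eta q - eta p)
                   - (xi q - xi p) * (eta r - eta p).
    by rewrite /k /cr /xi /eta; ring.
  by rewrite hq hr hq' hr'; ring.
have sqE : (al2 - al3) ^+ 2 = (k * mu2 - k * mu3) * cr.
  have e : al3 - al2 = (mu2 - mu3) * eta p by move: hp2; rewrite hp3; lra.
  transitivity ((mu2 - mu3) * (k * cr)); last by ring.
  by rewrite crE -(opprB al3) e; ring.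
have cr2 : `|cr| = 2 by lra.
by rewrite -[LHS]ger0_norm ?sqr_ge0 // sqE normrM cr2 mulrC.
Qed.

Lemma card_unit_triangles_on (L : {fset set (R * R)}) (z : R) :
  (forall l, l \in L -> is_line l) -> 1 <= z -> #|` L|%:R <= z ^+ 3 ->
  #|[set lm : L * L | `[< bound_unit_triangle l0 (val lm.1) (val lm.2) >]]%SET|%:R
  <= 10 * z ^+ 4.
Proof.
move=> Lline z1 Lz.
(* Only lines crossing [l0] have coordinates [(al, mu)]; both other sides of a triangle are such
   lines. *)
pose S : predArgType := {l : L | `[< ~ parallel l0 (val l) >]}.
have /choice [am amP] (s : S) : exists am : R * R,
    val (val s) = [set p | xi p = am.1 + am.2 * eta p].
  have [al [mu ->]] := nonparallel_line_coords (Lline _ (valP (val s)))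
    (asboolW (valP s)).
  by exists (al, mu).
have am_inj s t : (am s).1 = (am t).1 -> k * (am s).2 = k * (am t).2 -> s = t.
  move=> e1 /(mulfI (lt0r_neq0 k_gt0)) e2.
  by apply/val_inj/val_inj; rewrite /= !amP e1 e2.
have Sz : #|S|%:R <= z ^+ 3.
  by apply: le_trans Lz; rewrite ler_nat cardfE card_sig max_card.
have := card_unit_parabola_pairs am_inj z1 Sz; apply: le_trans.
rewrite ler_nat.
apply: (leq_card_charge (r := fun lm st => lm = (val st.1, val st.2))); last first.
  by move=> lm lm' st _ _ -> ->.
move=> [l m]; rewrite inE /= => /asboolP [nl nm _ _ [p [q [r]]]].
move=> [[pl pm] [q0 qm] [r0 rl] area].
pose s : S := exist _ l (asboolT nl); pose t : S := exist _ m (asboolT nm).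
exists (s, t) => //; rewrite inE /=; apply/eqP.
have sE := amP s; have tE := amP t; rewrite /= in sE tE.
move: pl rl pm qm; rewrite sE tE /= => pl rl pm qm.
have q0' : eta q = 0 by apply/eqP; rewrite subr_eq0; apply/eqP.
have r0' : eta r = 0 by apply/eqP; rewrite subr_eq0; apply/eqP.
by apply: (unit_area_coords pl pm q0' _ r0' _ area);
  [rewrite qm q0' mulr0 addr0 | rewrite rl r0' mulr0 addr0].
Qed.

End FixedLine.

(** * Upper bound: summation over the fixed line *)

Lemma card_unit_triples_ordered (R : realType) (L : {fset set (R * R)}) :
  (#|` unit_triples L| <= \sum_(l : L) #|[set lm : L * L |
     `[< bound_unit_triangle (val l) (val lm.1) (val lm.2) >]]%SET|)%N.
Proof.
pose Q (l : L) (lm : L * L) :=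
  `[< bound_unit_triangle (val l) (val lm.1) (val lm.2) >].
have -> : (\sum_l #|[set lm : L * L | Q l lm]%SET| =
    #|[set t : L * (L * L) | Q t.1 t.2]%SET|)%N.
  rewrite -sum1_card.
  under [RHS]eq_bigl => t do rewrite inE.
  rewrite -(pair_big_dep xpredT Q (fun _ _ => 1%N)); apply: eq_bigr => l _.
  by rewrite -sum1_card; apply: eq_bigl => lm; rewrite inE.
rewrite cardfE -cardsT.
apply: (leq_card_charge (r := fun (T : unit_triples L) (t : L * (L * L)) =>
  val T = [fset val t.1; val t.2.1; val t.2.2]%fset)); last first.
  by move=> T T' t _ _ e e'; apply: val_inj; rewrite /= e e'.
move=> T _; have := valP T; rewrite !inE /= => /and3P[].
rewrite fpowersetE => /fsubsetP TL _ /asboolP [l1 [l2 [l3 [TE tri]]]].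
have l1L : l1 \in L by apply: TL; rewrite TE !inE eqxx.
have l2L : l2 \in L by apply: TL; rewrite TE !inE eqxx orbT.
have l3L : l3 \in L by apply: TL; rewrite TE !inE eqxx orbT.
exists ([` l1L]%fset, ([` l2L]%fset, [` l3L]%fset)) => //.
by rewrite inE /Q; apply/asboolP.
Qed.

Lemma card_unit_triples_le (R : realType) (L : {fset set (R * R)}) :
  (forall l, l \in L -> is_line l) ->
  #|` unit_triples L|%:R <= 10 * #|` L|%:R `^ (7 / 3) :> R.
Proof.
move=> Lline.
(* The empty set is treated apart since [1 <= z] fails for it. *)
have [L0|Lpos] := posnP #|` L|.
  suff -> : #|` unit_triples L| = 0%N by rewrite mulr_ge0 // powR_ge0.
  apply/eqP; rewrite -leqn0 (leq_trans (card_unit_triples_ordered L)) //.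
  rewrite leqn0 sum_nat_eq0; apply/forallP => l.
  by have := fintype0 l; rewrite -cardfE L0 => /(_ erefl).
pose z : R := #|` L|%:R `^ (1 / 3).
have zX j : z ^+ j = #|` L|%:R `^ (j%:R / 3).
  by rewrite -powR_mulrn ?powR_ge0 // -powRrM; congr (_ `^ _); ring.
have z3 : z ^+ 3 = #|` L|%:R by rewrite zX divff // powRr1.
have z1 : 1 <= z.
  have one : 1 = 1 `^ (1 / 3) :> R by rewrite powR1.
  by rewrite one ge0_ler_powR ?nnegrE // ler1n.
have := card_unit_triples_ordered L; rewrite -(ler_nat R) => /le_trans; apply.
rewrite natr_sum; apply: (@le_trans _ _ (\sum_(l : L) 10 * z ^+ 4)).
  apply: ler_sum => l _; have [a [b [c [ab lE]]]] := Lline _ (valP l).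
  by rewrite lE; apply: card_unit_triangles_on => //; rewrite z3.
have -> : #|` L|%:R `^ (7 / 3) = z ^+ 7 by rewrite zX.
by rewrite sumr_const -cardfE -[_ *+ #|` L|]mulr_natl -z3 mulrCA -exprD.
Qed.

(** * Lower bound: a triangular grid *)

Section TriangularGrid.
Local Open Scope classical_set_scope.
Variables (R : realType) (h : nat).

Let rt : R := Num.sqrt 2.

(** The diagonal family is unbounded, so the first [n] indices give [n] lines for every [n]. The
    successor makes index [2 * h + (i + j)] the diagonal [l = i + j + 1]. *)
Definition grid_line (t : nat) : set (R * R) :=
  if (t < h)%N then [set p | 1 * p.1 + 0 * p.2 = rt * t%:R]
  else if (t < 2 * h)%N then [set p | 0 * p.1 + 1 * p.2 = rt * (t - h)%:R]
  else [set p | 1 * p.1 + 1 * p.2 = rt * (t - 2 * h).+1%:R].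

Lemma is_line_grid_line t : is_line (grid_line t).
Proof.
rewrite /grid_line; case: ifP => _; [|case: ifP => _].
- by exists 1, 0, (rt * t%:R); split=> // -[/eqP]; rewrite oner_eq0.
- by exists 0, 1, (rt * (t - h)%:R); split=> // -[/eqP]; rewrite oner_eq0.
- exists 1, 1, (rt * (t - 2 * h).+1%:R); split=> // -[/eqP].
  by rewrite oner_eq0.
Qed.

Let rt_gt0 : 0 < rt. Proof. by rewrite sqrtr_gt0. Qed.

Let rtI (i j : nat) : rt * i%:R = rt * j%:R -> i = j.
Proof. by move/(mulfI (lt0r_neq0 rt_gt0))/eqP; rewrite eqr_nat => /eqP. Qed.

(** One point separates lines of the same family; two points separate different families. *)
Lemma grid_line_inj : injective grid_line.
Proof.
have mem (l m : set (R * R)) : l = m -> forall p, l p -> m p by move=> ->.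
have neq l m p q : l = m :> set (R * R) -> l p -> l q -> ~ (m p /\ m q) -> False.
  by move=> lm lp lq; apply; split; apply: (mem _ _ lm).
move=> s t; wlog st : s t / (s <= t)%N.
  by move=> wl E; have [/wl|/ltnW/wl] := leqP s t; [apply|move/(_ (esym E))].
rewrite /grid_line; case: (ltnP s h) => hs.
  case: (ltnP t h) => ht.
    by move/mem/(_ (rt * s%:R, 0)) => /= E; apply: rtI; lra.
  case: (ltnP t (2 * h)) => ht' E; exfalso;
    apply: (neq _ _ (rt * s%:R, 0) (rt * s%:R, 1) E) => /=; lra.
have -> : (t < h)%N = false by lia.
case: (ltnP s (2 * h)) => hs'.
  case: (ltnP t (2 * h)) => ht'.
    move/mem/(_ (0, rt * (s - h)%:R)) => /= E.
    have : (s - h = t - h)%N by apply: rtI; lra.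
    lia.
  move=> E; exfalso.
  by apply: (neq _ _ (0, rt * (s - h)%:R) (1, rt * (s - h)%:R) E) => /=; lra.
have -> : (t < 2 * h)%N = false by lia.
move/mem/(_ (0, rt * (s - 2 * h).+1%:R)) => /= E.
have : ((s - 2 * h).+1 = (t - 2 * h).+1)%N by apply: rtI; lra.
lia.
Qed.

Lemma not_parallelI (l m : set (R * R)) p q :
  l p -> m p -> l q -> ~ m q -> ~ parallel l m.
Proof.
move=> lp mp lq mq [lm|lm]; first by apply: mq; rewrite -lm.
by have : (l `&` m) p by []; rewrite lm.
Qed.

(** The triangle is right-angled at [r] with both legs equal to [rt], so its area is
    [rt * rt / 2]. *)
Lemma grid_unit_triangle i j : (i < h)%N -> (j < h)%N ->
  bound_unit_triangle (grid_line i) (grid_line (h + j))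
    (grid_line (2 * h + (i + j))).
Proof.
move=> ih jh; rewrite /grid_line ih.
have -> : (h + j < h)%N = false by lia.
have -> : (h + j < 2 * h)%N by lia.
have -> : (2 * h + (i + j) < h)%N = false by lia.
have -> : (2 * h + (i + j) < 2 * h)%N = false by lia.
rewrite !addKn -natr1 natrD; set a : R := i%:R; set b : R := j%:R.
have rt2 : rt * rt = 2 by rewrite -expr2 sqr_sqrtr.
pose p := (rt * (a + 1), rt * b); pose q := (rt * a, rt * (b + 1)).
pose r := (rt * a, rt * b).
have rt0 := rt_gt0.
split.
- by apply: (@not_parallelI _ _ r q) => /=; lra.
- by apply: (@not_parallelI _ _ q r) => /=; lra.
- by apply: (@not_parallelI _ _ p r) => /=; lra.
- by rewrite -subset0 => w /= [[]]; lra.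
exists p, q, r; split=> /=; try by split; lra.
rewrite /triangle_area /=.
have -> : (rt * a - rt * (a + 1)) * (rt * b - rt * b) -
  (rt * a - rt * (a + 1)) * (rt * (b + 1) - rt * b) = rt * rt by ring.
by rewrite rt2 ger0_norm // divff.
Qed.

End TriangularGrid.

Lemma many_unit_triangles (R : realType) (n : nat) : (3 <= n)%N ->
  exists L : {fset set (R * R)},
    [/\ (forall l, l \in L -> is_line l), #|` L| = n
      & 36^-1 * n%:R ^+ 2 <= #|` unit_triples L|%:R :> R].
Proof.
(* The largest index used is [2 * h + 2 * (h - 1)], which is below [n] when [4 * h <= n + 1]. *)
move=> n3; pose h := (n.+1 %/ 4)%N.
have h4 : (4 * h <= n.+1)%N by rewrite /h; lia.
pose g := @grid_line R h.
exists [fset g t | t in iota 0 n]%fset; split.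
- by move=> l /imfsetP[t _ ->]; apply: is_line_grid_line.
- rewrite card_imfset /=; last exact: grid_line_inj.
  by rewrite undup_id ?iota_uniq // size_iota.
set L := [fset g t | t in _]%fset.
have gL t : (t < n)%N -> g t \in L.
  by move=> tn; apply/imfsetP; exists t; rewrite //= mem_iota.
have gE s t : (g s == g t) = (s == t) by apply/inj_eq/grid_line_inj.
pose T (ij : 'I_h * 'I_h) :=
  [fset g ij.1; g (h + ij.2)%N; g (2 * h + (ij.1 + ij.2))%N]%fset.
have TU ij : T ij \in unit_triples L.
  case: ij => i j; have ih := ltn_ord i; have jh := ltn_ord j.
  rewrite !inE /=; apply/and3P; split.
  - rewrite fpowersetE; apply/fsubsetP => l; rewrite !inE => /orP[/orP[]|] /eqP ->;
      apply: gL => /=; lia.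
  - rewrite /T /= -fsetUA cardfsU1 cardfs2 !inE !gE; lia.
  - apply/asboolP; exists (g i), (g (h + j)%N), (g (2 * h + (i + j))%N).
    by split=> //; apply: grid_unit_triangle.
have Tinj : injective T.
  move=> [i j] [i' j'] /fsetP TE.
  have ih := ltn_ord i; have jh := ltn_ord j.
  have ih' := ltn_ord i'; have jh' := ltn_ord j'.
  (* The vertical and the horizontal line of a triple determine [i] and [j]. *)
  have := TE (g i); have := TE (g (h + j)%N); rewrite !inE !gE !eqxx orbT /=.
  by move=> e1 e2; congr pair; apply: val_inj => /=; lia.
have : (h * h <= #|` unit_triples L|)%N.
  rewrite -[X in (X * X)%N]card_ord -card_prod -cardsT cardfE -[in leqRHS]cardsT.
  apply: (leq_card_charge (r := fun ij (t : unit_triples L) => T ij = val t)).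
    by move=> ij _; exists [` TU ij]%fset.
  by move=> ij ij' t _ _ <- /Tinj.
(* Flooring gives [n <= 4 * h + 2], and [3 <= n] gives [1 <= h]; squaring yields the constant
   1/36. *)
have h6 : (n <= 6 * h)%N by rewrite /h; lia.
have := leq_mul h6 h6; rewrite -!(ler_nat R) !natrM expr2; lra.
Qed.

Local Open Scope classical_set_scope.

Theorem theorem13 (R : realType) :
  (exists C : R, forall (n : nat) (L : {fset set (R * R)}),
     (forall l, l \in L -> is_line l) -> #|` L|%fset = n ->
     #|` unit_triples L|%fset%:R <= C * n%:R `^ (7 / 3))
  /\
  (exists c : R, 0 < c /\ forall n : nat, (3 <= n)%N ->
     exists L : {fset set (R * R)},
       [/\ (forall l, l \in L -> is_line l), #|` L|%fset = n
         & c * n%:R ^+ 2 <= #|` unit_triples L|%fset%:R]).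
Proof.
split.
  by exists 10 => n L Lline <-; apply: card_unit_triples_le.
exists 36^-1; split; first by rewrite invr_gt0.
exact: many_unit_triangles.
Qed.
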